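(* Let $S$ be a finite set with $|S|=n$, and let $1\le \ell\le n$. The map $f\mapsto f^{(\ell)}$ is a homomorphism of the semigroup of functions $S\to S$ under composition. Equivalently, for all functions $f,g:S\to S$ with matrices $F,G$ (so that $FG$ is the matrix of $g\circ f$), $$(FG)^{(\ell)}=F^{(\ell)}\,G^{(\ell)} .$$
   Context: For a function $f:S\to S$ the matrix $F$ of $f$ is the $n\times n$ matrix with $F_{ij}=1$ if $f(i)=j$ and $F_{ij}=0$ otherwise; thus composition ''first $f$, then $g$'' corresponds to the matrix product $FG$. Let $\mathcal P_\ell$ be the set of subsets of $S$ of cardinality $\ell$. The function $f^{(\ell)}:\mathcal P_\ell\cup\{\emptyset\}\to\mathcal P_\ell\cup\{\emptyset\}$ is defined by $f^{(\ell)}(\emptyset)=\emptyset$ and, for $I\in\mathcal P_\ell$, $f^{(\ell)}(I)=f(I)$ if $|f(I)|=\ell$, and $f^{(\ell)}(I)=\emptyset$ otherwise. The matrix $F^{(\ell)}$ of $f^{(\ell)}$ has rows and columns indexed by $\mathcal P_\ell$, with $F^{(\ell)}_{IJ}=1$ if $f(I)=J$ and $F^{(\ell)}_{IJ}=0$ otherwise. In $(FG)^{(\ell)}$, the matrix $FG$ is regarded as the matrix of the function $g\circ f$. *)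

(* Defs.v *)
From mathcomp Require Import all_boot all_algebra.

Set Implicit Arguments.
Unset Strict Implicit.
Unset Printing Implicit Defensive.

Import GRing.Theory.
Local Open Scope ring_scope.

(* A matrix whose rows and columns are labelled by a finite set [A] is a square
   matrix of size [#|A|], whose index [i] stands for the element [enum_val i]. *)

Definition fun_mx (R : nzSemiRingType) (S : finType) (f : S -> S) :
    'M[R]_#|S| :=
  \matrix_(i < #|S|, j < #|S|)
    if f (enum_val i) == enum_val j then 1 else 0.

Definition lsubsets (S : finType) (l : nat) : {set {set S}} :=
  [set I : {set S} | #|I| == l].

Definition lsubsets0 (S : finType) (l : nat) : finType :=
  {I : {set S} | I \in lsubsets S l :|: [set set0]}.

Definition lift_set (S : finType) (l : nat) (f : S -> S) (I : {set S}) :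
    {set S} :=
  if I == set0 then set0 else if #|f @: I| == l then f @: I else set0.

Lemma lift_set_in (S : finType) (l : nat) (f : S -> S) (I : {set S}) :
  lift_set l f I \in lsubsets S l :|: [set set0].
Proof.
rewrite /lift_set !inE; case: ifP => _; first by rewrite eqxx orbT.
by case: ifP => [->|_] //; rewrite eqxx orbT.
Qed.

(* The function f^(l) on the l-subsets together with the empty set. *)
Definition lift_fun (S : finType) (l : nat) (f : S -> S)
    (I : lsubsets0 S l) : lsubsets0 S l :=
  exist _ (lift_set l f (val I)) (lift_set_in l f (val I)).

(* The matrix F^(l). Rows and columns are labelled by the l-subsets only: an
   l-subset that f^(l) sends to the empty set gives a zero row. *)
Definition lift_mx (R : nzSemiRingType) (S : finType) (l : nat) (f : S -> S) :
    'M[R]_#|lsubsets S l| :=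
  \matrix_(i < #|lsubsets S l|, j < #|lsubsets S l|)
    if f @: (enum_val i : {set S}) == enum_val j then 1 else 0.

(* Main.v *)
Require Import Defs.
From mathcomp Require Import all_boot all_algebra.

Set Implicit Arguments.
Unset Strict Implicit.
Unset Printing Implicit Defensive.

Import GRing.Theory.
Local Open Scope ring_scope.

(** Taking images never increases cardinality. Hence an [l]-subset [I] that [f]
    collapses to fewer than [l] points cannot be brought back to [l] points by
    [g] ([card_imset_collapse]): sending collapsed sets to the empty set loses
    no information about [g \o f], which gives the composition law for
    [lift_fun].

    For matrices, [F] and [F^(l)] are both 0-1 matrices of a map [p : T -> T]
    cut down to the labels in a set [A]. Row [x] of the product [P Q] has a
    single candidate for a nonzero term, the column [p x]. If [p x] is in [A],
    that term is the indicator of [q (p x) = z]; if not, the row is zero, and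
    it agrees with the matrix of [q \o p] exactly when [q] does not bring
    [p x] back into [A] ([indicator_mxM]). For [F^(l)] this condition is the
    collapsing property above; for [F] all labels are in [A]. *)

(** The hypothesis says that a point leaving [A] under [p] does not return under
    [q]; this is what makes cutting down to [A] multiplicative. *)
Lemma indicator_mxM (R : nzSemiRingType) (T : finType) (A : {pred T})
    (p q : T -> T) :
  {in A, forall x, p x \notin A -> q (p x) \notin A} ->
  \matrix_(i < #|A|, j < #|A|)
     (if q (p (enum_val i)) == enum_val j then 1 else 0 : R)
  = (\matrix_(i < #|A|, j < #|A|)
       if p (enum_val i) == enum_val j then 1 else 0)
    *m (\matrix_(i < #|A|, j < #|A|)
          if q (enum_val i) == enum_val j then 1 else 0).
Proof.
move=> noreturn; apply/matrixP=> i k; rewrite !mxE.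
under eq_bigr => j _ do rewrite !mxE.
have [pA|pNA] := boolP (p (enum_val i) \in A).
  rewrite (bigD1 (enum_rank_in pA (p (enum_val i)))) //= enum_rankK_in // eqxx.
  rewrite mul1r big1 ?addr0 // => j jP; case: eqP => [pj|_]; last by rewrite mul0r.
  by case/eqP: jP; apply: enum_val_inj; rewrite enum_rankK_in.
rewrite big1 => [|j _].
  case: eqP => // qk; have := noreturn _ (enum_valP i) pNA.
  by rewrite qk enum_valP.
by case: eqP => [pj|_]; [rewrite pj enum_valP in pNA | rewrite mul0r].
Qed.

Lemma card_imset_collapse (S : finType) (f g : S -> S) (I : {set S}) :
  #|f @: I| != #|I| -> #|g @: (f @: I)| != #|I|.
Proof.
move=> fI; rewrite neq_ltn (leq_ltn_trans (leq_imset_card g _)) //.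
by rewrite ltn_neqAle fI leq_imset_card.
Qed.

Lemma lift_fun_comp (S : finType) (l : nat) (f g : S -> S) :
  lift_fun (l := l) (g \o f) =1 lift_fun (l := l) g \o lift_fun (l := l) f.
Proof.
case=> I lI; apply: val_inj; rewrite /= /lift_set.
have [//|I0] := eqVneq I set0; first by rewrite eqxx.
have {lI}/eqP <- : #|I| == l by move: lI; rewrite !inE (negPf I0) orbF.
rewrite imset_comp; have [_|/(card_imset_collapse g)/negPf->] := eqVneq #|f @: I|.
  by rewrite imset_eq0 (negPf I0).
by rewrite eqxx.
Qed.

Lemma fun_mx_comp (R : nzSemiRingType) (S : finType) (f g : S -> S) :
  fun_mx R (g \o f) = fun_mx R f *m fun_mx R g.
Proof. by apply: (indicator_mxM _ (p := f) (q := g)) => x _; rewrite !inE. Qed.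

Lemma lift_mx_comp (R : nzSemiRingType) (S : finType) (l : nat) (f g : S -> S) :
  lift_mx R l (g \o f) = lift_mx R l f *m lift_mx R l g.
Proof.
rewrite -(indicator_mxM R (p := fun I : {set S} => f @: I)
                          (q := fun I : {set S} => g @: I)) => [|I].
  by apply/matrixP=> i j; rewrite !mxE imset_comp.
by rewrite !inE => /eqP <-; apply: card_imset_collapse.
Qed.

Theorem mainTheorem1 (R : nzSemiRingType) (S : finType) (n l : nat)
    (hn : #|S| = n) (hl : (1 <= l <= n)%N) :
  (forall f g : S -> S,
     lift_fun (l := l) (g \o f) =1 lift_fun (l := l) g \o lift_fun (l := l) f)
  /\
  (forall f g : S -> S,
     fun_mx R (g \o f) = fun_mx R f *m fun_mx R g
     /\ lift_mx R l (g \o f) = lift_mx R l f *m lift_mx R l g).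
Proof.
split=> f g; first exact: lift_fun_comp.
by split; [apply: fun_mx_comp | apply: lift_mx_comp].
Qed.
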